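(* Consider the centralised market clearing problem (C), its reformulation (P), and the Lagrangian relaxation of (P) with respect to the duplication constraints, as given in the context. Consider the iterative process, started from arbitrary initial multipliers, where at each iteration $k\ge1$ the vector $x^{(k)}$ is obtained by solving the gas, electricity and heat subproblems with multipliers $\sigma_{co}^{g\to e\,(k)},\sigma_{co}^{g\to h\,(k)}$, and the multipliers are updated by $$\sigma_{co}^{g\to e\,(k+1)}=\sigma_{co}^{g\to e\,(k)}-\mu_k\big(x_{co,g}^{g\to e\,(k)}-x_{co,e}^{g\to e\,(k)}\big),\qquad \sigma_{co}^{g\to h\,(k+1)}=\sigma_{co}^{g\to h\,(k)}-\mu_k\big(x_{co,g}^{g\to h\,(k)}-x_{co,h}^{g\to h\,(k)}\big)$$ with step-length $\mu_k=\frac1k$. Then any accumulation point of the sequence of averaged iterates $\overline x^{(k)}=\frac1k\sum_{i=1}^kx^{(i)}$ is an optimal solution of (P), and hence provides an optimal solution of (C) (by taking as acceptance ratio of each conversion order the common value of its two duplicate variables).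
   Context: Carriers are gas ($g$), electricity ($e$), heat ($h$). $\mathcal O^c$ is a finite set of elementary orders of carrier $c$, with limit price $P_o^c$, quantity $Q_o^c$ ($<0$ for sell, $>0$ for buy) and acceptance ratio $x_o^c$. $\mathcal O^{g\to e},\mathcal O^{g\to h}$ are finite sets of conversion orders with conversion price $P_{co}$, capacity $Q_{co}>0$, efficiency $\eta_{co}>0$ (with the corresponding superscript). Problem (C): maximise $$\Theta(x)=\sum_{c\in\{g,e,h\}}\sum_{o\in\mathcal O^c}P_o^cQ_o^cx_o^c-\sum_{co\in\mathcal O^{g\to e}}P_{co}^{g\to e}Q_{co}^{g\to e}x_{co}^{g\to e}-\sum_{co\in\mathcal O^{g\to h}}P_{co}^{g\to h}Q_{co}^{g\to h}x_{co}^{g\to h}$$ subject to $\sum_{o\in\mathcal O^g}Q_o^gx_o^g+\sum_{co\in\mathcal O^{g\to e}}Q_{co}^{g\to e}x_{co}^{g\to e}+\sum_{co\in\mathcal O^{g\to h}}Q_{co}^{g\to h}x_{co}^{g\to h}=0$, $\sum_{o\in\mathcal O^e}Q_o^ex_o^e-\sum_{co\in\mathcal O^{g\to e}}\eta_{co}^{g\to e}Q_{co}^{g\to e}x_{co}^{g\to e}=0$, $\sum_{o\in\mathcal O^h}Q_o^hx_o^h-\sum_{co\in\mathcal O^{g\to h}}\eta_{co}^{g\to h}Q_{co}^{g\to h}x_{co}^{g\to h}=0$, and all variables in $[0,1]$. In (P) the acceptance variable of each conversion order is duplicated: $x_{co,g}^{g\to e},x_{co,g}^{g\to h}$ in the gas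 market, $x_{co,e}^{g\to e}$ in the electricity market, $x_{co,h}^{g\to h}$ in the heat market. Put $Q_{co,g}^{g\to e}=Q_{co}^{g\to e}$, $Q_{co,g}^{g\to h}=Q_{co}^{g\to h}$, $Q_{co,e}^{g\to e}=\eta_{co}^{g\to e}Q_{co}^{g\to e}$, $Q_{co,h}^{g\to h}=\eta_{co}^{g\to h}Q_{co}^{g\to h}$. Problem (P): maximise $$\Omega(x)=\sum_{c\in\{g,e,h\}}\sum_{o\in\mathcal O^c}P_o^cQ_o^cx_o^c-\sum_{co\in\mathcal O^{g\to e}}P_{co}^{g\to e}Q_{co}^{g\to e}x_{co,e}^{g\to e}-\sum_{co\in\mathcal O^{g\to h}}P_{co}^{g\to h}Q_{co}^{g\to h}x_{co,h}^{g\to h}$$ subject to the duplication constraints $x_{co,g}^{g\to e}=x_{co,e}^{g\to e}$ ($co\in\mathcal O^{g\to e}$) and $x_{co,g}^{g\to h}=x_{co,h}^{g\to h}$ ($co\in\mathcal O^{g\to h}$), the gas balance (G) $\sum_{o\in\mathcal O^g}Q_o^gx_o^g=-\sum_{co\in\mathcal O^{g\to e}}Q_{co,g}^{g\to e}x_{co,g}^{g\to e}-\sum_{co\in\mathcal O^{g\to h}}Q_{co,g}^{g\to h}x_{co,g}^{g\to h}$, the electricity balance (E) $\sum_{o\in\mathcal O^e}Q_o^ex_o^e=\sum_{co\in\mathcal O^{g\to e}}Q_{co,e}^{g\to e}x_{co,e}^{g\to e}$, the heat balance (H) $\sum_{o\in\mathcal O^h}Q_o^hx_o^h=\sum_{co\in\mathcal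 O^{g\to h}}Q_{co,h}^{g\to h}x_{co,h}^{g\to h}$, and all variables in $[0,1]$. The Lagrangian relaxation of (P), with the duplication constraints moved into the objective as $+\sum_{co}\sigma_{co}^{g\to e}(x_{co,g}^{g\to e}-x_{co,e}^{g\to e})+\sum_{co}\sigma_{co}^{g\to h}(x_{co,g}^{g\to h}-x_{co,h}^{g\to h})$, splits for fixed multipliers into the subproblems (all variables in $[0,1]$): Gas: maximise $\sum_{o\in\mathcal O^g}P_o^gQ_o^gx_o^g+\sum_{co}\sigma_{co}^{g\to e}x_{co,g}^{g\to e}+\sum_{co}\sigma_{co}^{g\to h}x_{co,g}^{g\to h}$ subject to (G). Electricity: maximise $\sum_{o\in\mathcal O^e}P_o^eQ_o^ex_o^e-\sum_{co}P_{co}^{g\to e}Q_{co}^{g\to e}x_{co,e}^{g\to e}-\sum_{co}\sigma_{co}^{g\to e}x_{co,e}^{g\to e}$ subject to (E). Heat: maximise $\sum_{o\in\mathcal O^h}P_o^hQ_o^hx_o^h-\sum_{co}P_{co}^{g\to h}Q_{co}^{g\to h}x_{co,h}^{g\to h}-\sum_{co}\sigma_{co}^{g\to h}x_{co,h}^{g\to h}$ subject to (H). The vector $x^{(k)}$ collects all variables of the three subproblems at iteration $k$; any optimal solution of each subproblem may be chosen. *)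

(* Defs.v *)
From HB Require Import structures.
From mathcomp Require Import all_boot all_order all_algebra.
From mathcomp Require Import all_classical all_reals all_analysis.

Set Implicit Arguments.
Unset Strict Implicit.
Unset Printing Implicit Defensive.

Import Order.TTheory GRing.Theory Num.Theory.
Import numFieldNormedType.Exports.

Local Open Scope classical_set_scope.
Local Open Scope ring_scope.

Inductive carrier := gas | elec | heat.

(* Quantities are negative for sell orders and positive for buy orders. *)
Record elem_book (R : realType) := ElemBook {
  elem_order :> finType;
  limit_price : elem_order -> R;
  quantity : elem_order -> R;
  quantity_neq0 : forall o, quantity o != 0
}.

(* The conversion orders from gas to one other carrier. The capacity is on the
   gas side. *)
Record conv_book (R : realType) := ConvBook {
  conv_order :> finType;
  conv_price : conv_order -> R;
  capacity : conv_order -> R;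
  efficiency : conv_order -> R;
  capacity_gt0 : forall co, 0 < capacity co;
  efficiency_gt0 : forall co, 0 < efficiency co
}.

Record market (R : realType) := Market {
  orders : carrier -> elem_book R;
  conv_ge : conv_book R;
  conv_gh : conv_book R
}.

Definition output (R : realType) (B : conv_book R) (co : B) : R :=
  efficiency co * capacity co.

Definition maximizes (T : Type) (R : realType) (S : set T) (f : T -> R)
    (x : T) : Prop :=
  S x /\ forall y, S y -> f y <= f x.

(* The centralised clearing problem (C) has one variable per order: its
   acceptance ratio. *)

Inductive cvar (R : realType) (M : market R) :=
  | CElem (c : carrier) of orders M c
  | CGe of conv_ge M
  | CGh of conv_gh M.
Arguments CElem {R M} c o.
Arguments CGe {R M} co.
Arguments CGh {R M} co.

Definition Theta (R : realType) (M : market R) (x : cvar M -> R) : R :=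
    \sum_(c <- [:: gas; elec; heat]) \sum_(o : orders M c)
       limit_price o * quantity o * x (CElem c o)
  - \sum_(co : conv_ge M) conv_price co * capacity co * x (CGe co)
  - \sum_(co : conv_gh M) conv_price co * capacity co * x (CGh co).

Definition C_feasible (R : realType) (M : market R) (x : cvar M -> R) : Prop :=
  [/\ \sum_(o : orders M gas) quantity o * x (CElem gas o)
      + \sum_(co : conv_ge M) capacity co * x (CGe co)
      + \sum_(co : conv_gh M) capacity co * x (CGh co) = 0,
      \sum_(o : orders M elec) quantity o * x (CElem elec o)
      - \sum_(co : conv_ge M) output co * x (CGe co) = 0,
      \sum_(o : orders M heat) quantity o * x (CElem heat o)
      - \sum_(co : conv_gh M) output co * x (CGh co) = 0
    & forall v, 0 <= x v <= 1].

Definition C_optimal (R : realType) (M : market R) (x : cvar M -> R) : Prop :=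
  maximizes (@C_feasible R M) (@Theta R M) x.

(* The reformulation (P) of (C) splits the acceptance ratio of each conversion
   order into two duplicates, one in the gas market (GeGas, GhGas) and one in
   the market of the output carrier (GeElec, GhHeat), constrained to be equal. *)

Inductive pvar (R : realType) (M : market R) :=
  | Elem (c : carrier) of orders M c
  | GeGas of conv_ge M
  | GeElec of conv_ge M
  | GhGas of conv_gh M
  | GhHeat of conv_gh M.
Arguments Elem {R M} c o.
Arguments GeGas {R M} co.
Arguments GeElec {R M} co.
Arguments GhGas {R M} co.
Arguments GhHeat {R M} co.

Definition carrier_of (R : realType) (M : market R) (v : pvar M) : carrier :=
  match v with
  | Elem c _ => c
  | GeGas _ | GhGas _ => gas
  | GeElec _ => elec
  | GhHeat _ => heat
  end.

Definition Omega (R : realType) (M : market R) (x : pvar M -> R) : R :=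
    \sum_(c <- [:: gas; elec; heat]) \sum_(o : orders M c)
       limit_price o * quantity o * x (Elem c o)
  - \sum_(co : conv_ge M) conv_price co * capacity co * x (GeElec co)
  - \sum_(co : conv_gh M) conv_price co * capacity co * x (GhHeat co).

Definition gas_balance (R : realType) (M : market R) (x : pvar M -> R) : Prop :=
  \sum_(o : orders M gas) quantity o * x (Elem gas o)
  = - \sum_(co : conv_ge M) capacity co * x (GeGas co)
    - \sum_(co : conv_gh M) capacity co * x (GhGas co).

Definition elec_balance (R : realType) (M : market R) (x : pvar M -> R) :
    Prop :=
  \sum_(o : orders M elec) quantity o * x (Elem elec o)
  = \sum_(co : conv_ge M) output co * x (GeElec co).

Definition heat_balance (R : realType) (M : market R) (x : pvar M -> R) :
    Prop :=
  \sum_(o : orders M heat) quantity o * x (Elem heat o)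
  = \sum_(co : conv_gh M) output co * x (GhHeat co).

Definition duplication (R : realType) (M : market R) (x : pvar M -> R) : Prop :=
  (forall co, x (GeGas co) = x (GeElec co)) /\
  (forall co, x (GhGas co) = x (GhHeat co)).

Definition P_feasible (R : realType) (M : market R) (x : pvar M -> R) : Prop :=
  [/\ duplication x, gas_balance x, elec_balance x, heat_balance x
    & forall v, 0 <= x v <= 1].

Definition P_optimal (R : realType) (M : market R) (x : pvar M -> R) : Prop :=
  maximizes (@P_feasible R M) (@Omega R M) x.

(* The common value of two duplicates is read off the gas market; it is the
   common value because a (P)-feasible point satisfies [duplication]. *)
Definition common_values (R : realType) (M : market R) (x : pvar M -> R) :
    cvar M -> R :=
  fun v => match v with
  | CElem c o => x (Elem c o)
  | CGe co => x (GeGas co)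
  | CGh co => x (GhGas co)
  end.

(* Relaxing [duplication] in (P) with the terms
   sge co * (x (GeGas co) - x (GeElec co)) and
   sgh co * (x (GhGas co) - x (GhHeat co)) added to [Omega] leaves one
   independent subproblem per carrier. Each is stated on full vectors of
   (P), but its constraints and objective involve only the variables of its own
   carrier, so the other coordinates are irrelevant to it. *)

Definition box (R : realType) (M : market R) (c : carrier) (x : pvar M -> R) :
    Prop :=
  forall v, carrier_of v = c -> 0 <= x v <= 1.

Definition gas_objective (R : realType) (M : market R)
    (sge : conv_ge M -> R) (sgh : conv_gh M -> R) (x : pvar M -> R) : R :=
    \sum_(o : orders M gas) limit_price o * quantity o * x (Elem gas o)
  + \sum_(co : conv_ge M) sge co * x (GeGas co)
  + \sum_(co : conv_gh M) sgh co * x (GhGas co).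

Definition elec_objective (R : realType) (M : market R)
    (sge : conv_ge M -> R) (x : pvar M -> R) : R :=
    \sum_(o : orders M elec) limit_price o * quantity o * x (Elem elec o)
  - \sum_(co : conv_ge M) conv_price co * capacity co * x (GeElec co)
  - \sum_(co : conv_ge M) sge co * x (GeElec co).

Definition heat_objective (R : realType) (M : market R)
    (sgh : conv_gh M -> R) (x : pvar M -> R) : R :=
    \sum_(o : orders M heat) limit_price o * quantity o * x (Elem heat o)
  - \sum_(co : conv_gh M) conv_price co * capacity co * x (GhHeat co)
  - \sum_(co : conv_gh M) sgh co * x (GhHeat co).

Definition solves_subproblems (R : realType) (M : market R)
    (sge : conv_ge M -> R) (sgh : conv_gh M -> R) (x : pvar M -> R) : Prop :=
  [/\ maximizes [set y : pvar M -> R | gas_balance y /\ box gas y]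
        (gas_objective sge sgh) x,
      maximizes [set y : pvar M -> R | elec_balance y /\ box elec y]
        (elec_objective sge) x
    & maximizes [set y : pvar M -> R | heat_balance y /\ box heat y]
        (heat_objective sgh) x].

(* Iterations are numbered from 1: index 0 of every sequence is unused, and the
   initial multipliers [sge 1] and [sgh 1] are unconstrained. *)
Definition lagrangian_iteration (R : realType) (M : market R) (mu : nat -> R)
    (sge : nat -> conv_ge M -> R) (sgh : nat -> conv_gh M -> R)
    (x : nat -> pvar M -> R) : Prop :=
  forall k : nat, (1 <= k)%N ->
  [/\ solves_subproblems (sge k) (sgh k) (x k),
      forall co, sge k.+1 co
                 = sge k co - mu k * (x k (GeGas co) - x k (GeElec co))
    & forall co, sgh k.+1 co
                 = sgh k co - mu k * (x k (GhGas co) - x k (GhHeat co))].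

(* [pvar M] is finite, so the topology of pointwise convergence is the usual
   topology of the Euclidean space of vectors indexed by [pvar M]. *)
Definition averages (R : realType) (M : market R) (x : nat -> pvar M -> R)
    (k : nat) : {ptws pvar M -> R} :=
  fun v => k%:R^-1 * \sum_(1 <= i < k.+1) x i v.

(* Main.v *)
(* The proof follows Larsson, Patriksson and Stroemberg's ergodic convergence of
   dual subgradient schemes. The step 1/k makes the averages of the relaxed
   constraint violations telescope: as
     sigma_i - sigma_(i+1) = (violation at x_i) / i,
   their average up to k is the average of sigma_1, ..., sigma_k minus
   sigma_(k+1), which tends to 0 as soon as the multipliers converge. They do:
   (P) is a linear program, so by Farkas' lemma its dual is attained; the
   distance of sigma_k to any dual optimum is nonincreasing up to summable
   errors, and the divergence of sum 1/k forces some cluster point to be a dual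
   optimum, which is then the limit t. Since x_k maximises the Lagrangian at
   sigma_k, close to t, an average of the x_k nearly attains the optimal value
   of the Lagrangian at t, hence that of Omega because its violations vanish. *)
Require Import Defs.
From mathcomp Require Import all_boot all_order all_algebra.
From mathcomp Require Import all_classical all_reals all_analysis.
From mathcomp Require Import ring lra.

Set Implicit Arguments.
Unset Strict Implicit.
Unset Printing Implicit Defensive.

Import Order.TTheory GRing.Theory Num.Theory.
Import numFieldNormedType.Exports.

Local Open Scope classical_set_scope.
Local Open Scope ring_scope.

(** * Linear functionals, Farkas' lemma and Lagrange multipliers *)

Lemma scalar0 (R : pzRingType) (W : lmodType R) (f : W -> R) :
  scalar f -> f 0 = 0.
Proof. by move=> fL; rewrite -[0](addNr (0 : W)) -scaleN1r fL mulN1r addNr. Qed.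

Lemma scalarZ (R : pzRingType) (W : lmodType R) (f : W -> R) a x :
  scalar f -> f (a *: x) = a * f x.
Proof. by move=> fL; rewrite -[a *: x]addr0 fL scalar0 ?addr0. Qed.

Lemma scalarD (R : pzRingType) (W : lmodType R) (f : W -> R) x y :
  scalar f -> f (x + y) = f x + f y.
Proof. by move=> fL; rewrite -[x]scale1r fL mul1r scale1r. Qed.

Lemma scalar_sum (R : pzRingType) (W : lmodType R) (f : W -> R) (I : Type)
    (r : seq I) (F : I -> W) :
  scalar f -> f (\sum_(i <- r) F i) = \sum_(i <- r) f (F i).
Proof.
move=> fL; elim: r => [|i r IH]; first by rewrite !big_nil scalar0.
by rewrite !big_cons scalarD // IH.
Qed.

(* Bartl's induction: if dropping the constraint [i] breaks the implication at
   some [z], normalised by [A i z = 1], then projecting along [z] onto the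
   kernel of [A i] removes that constraint. *)
Lemma farkas_seq (R : realFieldType) (W : lmodType R) (I : eqType) (r : seq I)
    (A : I -> W -> R) (b : W -> R) :
  uniq r -> (forall i, scalar (A i)) -> scalar b ->
  (forall x, (forall i, i \in r -> A i x <= 0) -> b x <= 0) ->
  exists2 u : I -> R, (forall i, 0 <= u i) &
    forall x, b x = \sum_(i <- r) u i * A i x.
Proof.
elim: r A b => [|i r IH] A b /=.
  move=> _ _ bL b_le0; exists (fun=> 0) => // x; rewrite big_nil.
  apply/eqP; rewrite eq_le b_le0 //=.
  by rewrite -oppr_le0 -mulN1r -scalarZ // b_le0.
case/andP=> ir ur AL bL b_le0.
have cons_sum u c x : \sum_(j <- i :: r) (if j == i then c else u j) * A j x
    = c * A i x + \sum_(j <- r) u j * A j x.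
  rewrite big_cons eqxx; congr (_ + _); apply: eq_big_seq => j jr.
  by case: eqP => // ji; rewrite ji (negbTE ir) in jr.
have [br_le0|] :=
    pselect (forall x, (forall j, j \in r -> A j x <= 0) -> b x <= 0).
  have [u u_ge0 bE] := IH A b ur AL bL br_le0.
  exists (fun j => if j == i then 0 else u j); first by move=> j; case: ifP.
  by move=> x; rewrite cons_sum mul0r add0r.
move=> /existsNP[z /not_implyP[Az /negP]]; rewrite -ltNge => bz.
have Aiz : 0 < A i z.
  rewrite ltNge; apply/negP => Aiz; move: bz; rewrite ltNge b_le0 // => j.
  by rewrite inE => /orP[/eqP->|/Az].
pose t x := A i x / A i z.
have [||x Hx|u u_ge0 bE] :=
    IH (fun j x => A j (- t x *: z + x)) (fun x => b (- t x *: z + x)) ur.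
- by move=> j a x y; rewrite !AL /t AL; field; rewrite gt_eqF.
- by move=> a x y; rewrite !bL /t AL; field; rewrite gt_eqF.
- apply: b_le0 => j; rewrite inE => /orP[/eqP->|/Hx //].
  by rewrite AL /t mulNr divfK ?gt_eqF // addNr.
(* The value that the required identity forces on the multiplier of [A i] at [x = z]. *)
pose c := (b z - \sum_(j <- r) u j * A j z) / A i z.
exists (fun j => if j == i then c else u j).
  move=> j; case: ifP => // _; rewrite divr_ge0 ?(ltW Aiz) // subr_ge0.
  apply: le_trans (ltW bz); rewrite big_seq; apply: sumr_le0 => k kr.
  by rewrite mulr_ge0_le0 // Az.
move=> x; rewrite cons_sum.
have := bE x; rewrite bL; under eq_bigr do rewrite AL mulrDr mulrCA.
rewrite big_split /= -mulr_sumr => /(canRL (addKr _)) ->.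
by rewrite /c /t; field; rewrite gt_eqF.
Qed.

Lemma lagrange_multipliers (R : realFieldType) (W : lmodType R) (I J : finType)
    (A : I -> W -> R) (a : I -> R) (D : J -> W -> R) (b : W -> R) (c : R)
    (y0 : W) :
  (forall i, scalar (A i)) -> (forall j, scalar (D j)) -> scalar b ->
  (forall i, A i y0 <= a i) -> (forall j, D j y0 = 0) ->
  (forall y, (forall i, A i y <= a i) -> (forall j, D j y = 0) -> b y <= c) ->
  exists s : J -> R, forall y, (forall i, A i y <= a i) ->
    b y + \sum_j s j * D j y <= c.
Proof.
move=> AL DL bL Ay0 Dy0 b_le.
(* Homogenisation: the second component [w.2] replaces the constant [1]. *)
pose B (k : unit + (I + (J + J))) (w : W * R^o) : R :=
  match k with
  | inl _ => - w.2
  | inr (inl i) => A i w.1 - a i * w.2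
  | inr (inr (inl j)) => D j w.1
  | inr (inr (inr j)) => - D j w.1
  end.
have BL k : scalar (B k).
  case: k => [_|[i|[j|j]]] r [w1 w2] [v1 v2] /=.
  - by rewrite /GRing.scale /=; ring.
  - by rewrite AL /GRing.scale /=; ring.
  - by rewrite DL.
  - by rewrite DL; ring.
pose b' (w : W * R^o) : R := b w.1 - c * w.2.
have b'L : scalar b'.
  by move=> r [w1 w2] [v1 v2]; rewrite /b' /= bL /GRing.scale /=; ring.
have [|u u_ge0 b'E] := @farkas_seq R (W * R^o)%type _ (index_enum _) B b'
    (index_enum_uniq _) BL b'L.
  case=> y t Bw; rewrite /b' /=.
  have {}Bw k : B k (y, t) <= 0 by rewrite Bw ?mem_index_enum.
  have t_ge0 : 0 <= t by have := Bw (inl tt); rewrite /= oppr_le0.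
  have Ay i : A i y <= a i * t by have := Bw (inr (inl i)); rewrite /= subr_le0.
  have Dy j : D j y = 0.
    have := Bw (inr (inr (inl j))); have := Bw (inr (inr (inr j))).
    by rewrite /=; lra.
  move: t_ge0; rewrite le_eqVlt => /orP[/eqP t0|t_gt0]; last first.
    have : b (t^-1 *: y) <= c.
      apply: b_le => [i|j]; last by rewrite scalarZ // Dy mulr0.
      by rewrite scalarZ // mulrC ler_pdivrMr.
    by rewrite scalarZ // mulrC ler_pdivrMr // subr_le0.
  rewrite -t0 mulr0 subr0 leNgt; apply/negP => by_gt0.
  (* [y] is a recession direction, along which [b] is unbounded *)
  have : b ((c - b y0 + 1) / b y *: y + y0) <= c.
    have q_ge0 : 0 <= (c - b y0 + 1) / b y.
      rewrite divr_ge0 ?(ltW by_gt0) //.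
      by rewrite addr_ge0 // subr_ge0 b_le.
    apply: b_le => [i|j]; last by rewrite DL Dy Dy0 mulr0 addr0.
    rewrite AL; have : A i y <= 0 by have := Ay i; rewrite -t0 mulr0.
    by move/(mulr_ge0_le0 q_ge0) => ?; have := Ay0 i; lra.
  (* The factor of [y] was chosen to make [b] equal to [c + 1] at this point. *)
  by rewrite bL divfK ?gt_eqF //; lra.
exists (fun j => u (inr (inr (inr j))) - u (inr (inr (inl j)))) => y Ay.
have := b'E (y, 1); rewrite /b' /= mulr1 => /(canRL (subrK _)) ->.
rewrite !big_sumType /= (bigD1 tt) //= big1 => [|[] //]; rewrite addr0.
have : \sum_i u (inr (inl i)) * (A i y - a i * 1) <= 0.
  by apply: sumr_le0 => i _; rewrite mulr1 mulr_ge0_le0 // subr_le0.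
under [X in _ + (_ + (_ + X)) + _ + _]eq_bigr do rewrite mulrN.
under [X in _ + X <= _]eq_bigr do rewrite mulrBl.
rewrite sumrB sumrN; have := u_ge0 (inl tt); lra.
Qed.

(** * Averages, cluster points and perturbed descent of real sequences *)

Definition mean (R : unitRingType) (W : lmodType R) (x : nat -> W) (k : nat) :
    W :=
  k%:R^-1 *: \sum_(1 <= i < k.+1) x i.

Lemma scalar_mean (R : unitRingType) (W : lmodType R) (f : W -> R)
    (x : nat -> W) (k : nat) :
  scalar f -> f (mean x k) = k%:R^-1 * \sum_(1 <= i < k.+1) f (x i).
Proof. by move=> fL; rewrite scalarZ // scalar_sum. Qed.

Lemma cvg_mean (R : realType) (u : nat -> R) (l : R) :
  u @ \oo --> l -> (fun k => k%:R^-1 * \sum_(1 <= i < k.+1) u i) @ \oo --> l.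
Proof.
(* [cesaro] averages from index 0, the means here start at 1; shifting by one aligns them. *)
move=> ul; rewrite -cvg_shiftS /=.
have /cesaro : [sequence u n.+1]_n @ \oo --> l by rewrite cvg_shiftS.
rewrite /arithmetic_mean /series /=.
apply: cvg_trans; apply: near_eq_cvg; apply: nearW => k.
by rewrite big_add1.
Qed.

Lemma cluster_ge (R : realType) (u v : nat -> R) (l m : R) :
  cluster (u @ \oo) l -> v @ \oo --> m ->
  (forall k, (1 <= k)%N -> v k <= u k) -> m <= l.
Proof.
move=> /cluster_eventuallyP ul vm vu; apply/ler_addgt0Pr => e e_gt0.
have e2_gt0 : 0 < e / 2 by rewrite divr_gt0.
have [n _ nv] : \forall k \near \oo, `|m - v k| < e / 2.
  by move/cvgrPdist_lt : vm; exact.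
have [k nk uk] := ul _ (maxn 1 n) e2_gt0.
move: nk; rewrite geq_max => /andP[k_gt0 /nv /= /ltr_normlP[_ vk]].
have := vu k k_gt0; move: uk => /ler_normlP[]; lra.
Qed.

Lemma cluster_cvg_eq (R : realType) (u : nat -> R) (l m : R) :
  cluster (u @ \oo) l -> u @ \oo --> m -> l = m.
Proof.
move=> /cluster_eventuallyP ul um; apply/eqP; rewrite -subr_eq0 -normr_le0.
apply/ler_addgt0Pr => e e_gt0; rewrite add0r.
have e2_gt0 : 0 < e / 2 by rewrite divr_gt0.
have [n _ nu] : \forall k \near \oo, `|m - u k| < e / 2.
  by move/cvgrPdist_lt : um; exact.
have [k nk uk] := ul _ n e2_gt0; rewrite [e]splitr.
apply: le_trans (ler_distD (u k) _ _) _.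
by rewrite lerD // distrC ltW // nu.
Qed.

(* The sequence [a k + 2 * N / k] is nonincreasing, because
   [1 / k ^ 2 <= 2 * (1 / k - 1 / k.+1)]. *)
Lemma descent_le (R : realFieldType) (a : nat -> R) (N : R) (m k : nat) :
  0 <= N -> (1 <= m)%N ->
  (forall i, (m <= i)%N -> a i.+1 <= a i + N / i%:R ^+ 2) -> (m <= k)%N ->
  a k <= a m + 2 * N / m%:R - 2 * N / k%:R.
Proof.
move=> N_ge0 m_gt0 aS; elim: k => [|k IH]; first by case: m m_gt0 {aS}.
rewrite leq_eqVlt => /orP[/eqP <-|]; first by lra.
rewrite ltnS => mk; have k_gt0 : (0 < k)%N by exact: leq_trans mk.
apply: le_trans (aS k mk) _; apply: le_trans (lerD (IH mk) (lexx _)) _.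
have k_ge1 : 1 <= k%:R :> R by rewrite ler1n.
rewrite -(natr1 k).
have -> : 2 * N / (k%:R + 1) =
    2 * N / k%:R - N / k%:R ^+ 2 - N * (k%:R - 1) / (k%:R ^+ 2 * (k%:R + 1)).
  by field; rewrite !gt_eqF //; lra.
have : 0 <= N * (k%:R - 1) / (k%:R ^+ 2 * (k%:R + 1)).
  by rewrite divr_ge0 // ?mulr_ge0 ?exprn_ge0 //; lra.
lra.
Qed.

(** If [delta] stayed above [e], then [a] would lose at least [2 * e / k] at each late step, up to
    summable errors; as [a] is nonnegative, the harmonic series would be bounded. *)
Lemma descent_frequently (R : realType) (a delta : nat -> R) (N : R) :
  0 <= N -> (forall k, 0 <= a k) ->
  (forall k, (1 <= k)%N ->
     a k.+1 <= a k - 2 / k%:R * delta k + N / k%:R ^+ 2) ->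
  forall (e : R) (n : nat), 0 < e ->
  exists k, [/\ (n <= k)%N, (1 <= k)%N & delta k < e].
Proof.
move=> N_ge0 a_ge0 aS e n e_gt0; apply: contrapT => noK.
have delta_ge k : (n < k)%N -> e <= delta k.
  move=> nk; rewrite leNgt; apply/negP => dk; apply: noK; exists k.
  by split=> //; [exact: ltnW|exact: leq_trans nk].
(* Adds back the guaranteed losses. As [harmonic i] is [1 / i.+1], the sum runs over [1 / j] for
   [1 <= j < k], and passing from [k] to [k.+1] adds [2 * e / k]. *)
pose a' k := a k + 2 * e * \sum_(i < k.-1) harmonic i.
have a'_le k : (n < k)%N -> a' k <= a' n.+1 + 2 * N / n.+1%:R.
  move=> nk; have : a' k <= a' n.+1 + 2 * N / n.+1%:R - 2 * N / k%:R.
    apply: descent_le => // -[//|i] ni.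
    rewrite /a' /= big_ord_recr /=; set S := \sum_(j < i) _.
    have := aS i.+1 isT; have : 2 / i.+1%:R * e <= 2 / i.+1%:R * delta i.+1.
      by rewrite ler_wpM2l ?delta_ge // divr_ge0.
    have -> : 2 * e * (S + i.+1%:R^-1) = 2 * e * S + 2 / i.+1%:R * e by ring.
    move: (2 / _) (N / _) (delta _) (a i.+1) (a i.+2) S => ? ? ? ? ? ?; lra.
  by move/le_trans; apply; rewrite gerBl divr_ge0 // mulr_ge0.
apply: (@dvg_harmonic R); apply: nondecreasing_is_cvgn.
  by apply: nondecreasing_series => i _ _; rewrite /= invr_ge0.
exists ((a' n.+1 + 2 * N / n.+1%:R) / (2 * e)) => _ [k _ <-].
rewrite ler_pdivlMr; last by rewrite mulr_gt0.
have : series harmonic k <= series (@harmonic R) (n + k)%N.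
  apply: nondecreasing_series; last exact: leq_addl.
  by move=> i _ _; rewrite /= invr_ge0.
rewrite /series /= !big_mkord => sum_le.
have := a'_le (n + k).+1; rewrite ltnS leq_addr => /(_ isT).
apply: le_trans; rewrite /a' /= mulrC ler_wpDl //.
by rewrite ler_wpM2l // mulr_ge0 // ltW.
Qed.

(** By [descent_le], the terms after an index [m] exceed [a m] by at most [2 * N / m], so one small
    value at a late index keeps all later ones small. *)
Lemma descent_cvg0 (R : realType) (a : nat -> R) (N : R) :
  0 <= N -> (forall k, 0 <= a k) ->
  (forall k, (1 <= k)%N -> a k.+1 <= a k + N / k%:R ^+ 2) ->
  (forall (e : R) (n : nat), 0 < e -> exists2 k, (n <= k)%N & a k < e) ->
  a @ \oo --> 0.
Proof.
move=> N_ge0 a_ge0 aS a_freq; apply/cvgrPdist_lt => e e_gt0.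
have e2_gt0 : 0 < e / 2 by rewrite divr_gt0.
pose n := (Num.trunc ((e / 2)^-1 * (2 * N))).+1.
have [m nm am] := a_freq _ n e2_gt0.
have m_gt0 : (1 <= m)%N by exact: leq_trans nm.
have Nm : 2 * N / m%:R < e / 2.
  rewrite ltr_pdivrMr ?ltr0n // -ltr_pdivrMl //.
  by rewrite (lt_le_trans (truncnS_gt _)) // ler_nat.
exists m => // k /= mk.
rewrite sub0r normrN ger0_norm //.
have := descent_le N_ge0 m_gt0 (fun i mi => aS i (leq_trans m_gt0 mi)) mk.
have : 0 <= 2 * N / k%:R by rewrite divr_ge0 // mulr_ge0.
lra.
Qed.

(** * Limits in the pointwise topology and telescoping means *)

Lemma ptws_eval_continuous (T : Type) (U : topologicalType) (t : T) :
  continuous (fun f : {ptws T -> U} => f t).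
Proof.
move=> f; have /cvg_sup/(_ t) ft : nbhs f --> f by exact: cvg_id.
by move=> A fA; apply: ft; exact: initial_continuous fA.
Qed.

Lemma cvg_sumr (R : realType) (T : Type) (F : set_system T) (I : finType)
    (u : I -> T -> R) (l : I -> R) :
  Filter F -> (forall i, u i @ F --> l i) ->
  (fun x => \sum_i u i x) @ F --> \sum_i l i.
Proof.
move=> FF ul; apply: (@cvg_big R I +%R 0 xpredT) => //.
exact: add_continuous.
Qed.

Lemma cluster_comp (T U : topologicalType) (f : T -> U) (u : nat -> T) (p : T) :
  continuous f -> cluster (u @ \oo) p -> cluster ((f \o u) @ \oo) (f p).
Proof.
move=> f_cont up A B uA /f_cont pB.
by have [q [Aq Bq]] := up (f @^-1` A) (f @^-1` B) uA pB; exists (f q).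
Qed.

(** Abel summation turns the expression into the mean of [e 1], ..., [e k] minus [e k.+1], and both
    tend to [l]. The weights [i] will cancel the step lengths [1 / i]. *)
Lemma mean_steps_cvg0 (R : realType) (e : nat -> R) (l : R) :
  e @ \oo --> l ->
  (fun k => k%:R^-1 * \sum_(1 <= i < k.+1) i%:R * (e i - e i.+1)) @ \oo --> 0.
Proof.
move=> el; have e1l : [sequence e n.+1]_n @ \oo --> l by rewrite cvg_shiftS.
rewrite -[X in _ --> X](subrr l).
apply: cvg_trans (cvgB (cvg_mean el) e1l); apply: near_eq_cvg.
exists 1%N => // k /= k_gt0.
have abel : \sum_(1 <= i < k.+1) i%:R * (e i - e i.+1)
    = \sum_(1 <= i < k.+1) e i - k%:R * e k.+1.
  elim: k {k_gt0} => [|k IH]; first by rewrite !big_geq // mul0r subrr.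
  by rewrite big_nat_recr // [in RHS]big_nat_recr //= IH -(natr1 k); ring.
by rewrite fctE abel mulrBr mulKf // pnatr_eq0 -lt0n.
Qed.

(** * The dual subgradient scheme with steps [1 / k] *)

Definition lagrangian (R : pzRingType) (W : Type) (J : finType) (f : W -> R)
    (D : J -> W -> R) (s : J -> R) (y : W) : R :=
  f y + \sum_j s j * D j y.

(** For fixed [y] the Lagrangian is affine in the multipliers with slope [D j y], so the cross term
    of the expanded square is the difference of the two Lagrangians. *)
Lemma multipliers_step (R : realType) (W : Type) (J : finType)
    (f : W -> R) (D : J -> W -> R) (y : W) (s s' t : J -> R) (m : R) :
  (forall j, `|D j y| <= 1) -> (forall j, s' j = s j - m * D j y) ->
  \sum_j (s' j - t j) ^+ 2 <=
  \sum_j (s j - t j) ^+ 2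
  - 2 * m * (lagrangian f D s y - lagrangian f D t y) + #|J|%:R * m ^+ 2.
Proof.
move=> D_le1 s'E.
have -> : lagrangian f D s y - lagrangian f D t y
    = \sum_j (s j - t j) * D j y.
  rewrite /lagrangian opprD addrACA subrr add0r -sumrB.
  by apply: eq_bigr => j _; rewrite mulrBl.
have -> : #|J|%:R * m ^+ 2 = \sum_(j : J) m ^+ 2.
  by rewrite sumr_const mulr_natl.
rewrite mulr_sumr -sumrB -big_split /=; apply: ler_sum => j _.
have : m ^+ 2 * D j y ^+ 2 <= m ^+ 2.
  rewrite ler_piMr ?sqr_ge0 // -[D j y ^+ 2]ger0_norm ?sqr_ge0 // normrX.
  by rewrite expr_le1.
by rewrite s'E; nra.
Qed.

Lemma lagrangianN_continuous (R : realType) (T : topologicalType) (W : Type)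
    (J : finType) (f : W -> R) (D : J -> W -> R) (y : W) (g : T -> J -> R) :
  (forall j, continuous (g ^~ j)) ->
  continuous (fun t => - lagrangian f D (g t) y).
Proof.
move=> g_cont t; apply: cvgN; apply: cvgD; first exact: cvg_cst.
apply: cvg_sumr => j; apply: cvgM; last exact: cvg_cst.
exact: g_cont.
Qed.

Lemma sqr_dist_continuous (R : realType) (T : topologicalType) (J : finType)
    (s : J -> R) (g : T -> J -> R) :
  (forall j, continuous (g ^~ j)) ->
  continuous (fun t => \sum_j (g t j - s j) ^+ 2).
Proof.
move=> g_cont t; apply: cvg_sumr => j.
apply: (@cvg_comp _ _ _ (fun t => g t j - s j) (fun z => z ^+ 2)).
  by apply: cvgB; [exact: g_cont|exact: cvg_cst].
exact: exprn_continuous.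
Qed.

(** The existence of one dual optimum [s0] bounds the multipliers and yields indices where the dual
    value is nearly [c]. A cluster point [t] along these is itself a dual optimum, so the descent
    estimate applies again with [t] in place of [s0]. *)
Lemma multipliers_cvg (R : realType) (W : Type) (J : finType) (Y : set W)
    (f : W -> R) (D : J -> W -> R) (c : R) (s0 : J -> R)
    (s : nat -> J -> R) (x : nat -> W) :
  (forall y j, Y y -> `|D j y| <= 1) ->
  (forall y, Y y -> lagrangian f D s0 y <= c) ->
  (forall k, (1 <= k)%N -> maximizes Y (lagrangian f D (s k)) (x k)) ->
  (forall k, (1 <= k)%N -> c <= lagrangian f D (s k) (x k)) ->
  (forall k j, (1 <= k)%N -> s k.+1 j = s k j - k%:R^-1 * D j (x k)) ->
  exists t : J -> R, forall j, s ^~ j @ \oo --> t j.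
Proof.
move=> D_le1 s0_dual x_max x_ge sS.
pose N : R := #|J|%:R; pose dist (t : J -> R) k := \sum_j (s k j - t j) ^+ 2.
have N_ge0 : 0 <= N by exact: ler0n.
have dist_ge0 t k : 0 <= dist t k by apply: sumr_ge0 => j _; exact: sqr_ge0.
have distS t k : (1 <= k)%N -> dist t k.+1 <= dist t k
    - 2 / k%:R * (lagrangian f D (s k) (x k) - lagrangian f D t (x k))
    + N / k%:R ^+ 2.
  move=> k1; rewrite -exprVn; apply: multipliers_step => j; last exact: sS.
  by apply: D_le1; have [] := x_max k k1.
have dist_leS t : (forall y, Y y -> lagrangian f D t y <= c) ->
    forall k, (1 <= k)%N -> dist t k.+1 <= dist t k + N / k%:R ^+ 2.
  move=> t_dual k k1; apply: le_trans (distS t k k1) _.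
  rewrite lerD2r gerBl mulr_ge0 ?divr_ge0 // subr_ge0.
  by apply: le_trans (x_ge k k1); apply: t_dual; have [] := x_max k k1.
(* The maximal Lagrangian at [s k] is within [1 / i.+1] of [c]. Requiring [i <= k] makes the chosen
   indices tend to infinity, although they need not increase. *)
pose good i k := [/\ (i <= k)%N, (1 <= k)%N &
  lagrangian f D (s k) (x k) < c + i.+1%:R^-1].
have /choice[n n_ge] : forall i, exists k, good i k.
  move=> i.
  have i_gt0 : 0 < i.+1%:R^-1 :> R by rewrite invr_gt0.
  have [k [ik k1 dk]] :=
    descent_frequently N_ge0 (dist_ge0 s0) (distS s0) i i_gt0.
  exists k; split=> //; rewrite -ltrBlDl; apply: le_lt_trans dk.
  by rewrite lerD2l lerN2 s0_dual //; have [] := x_max k k1.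
pose B := dist s0 1 + 2 * N.
have dist_le k : (1 <= k)%N -> dist s0 k <= B.
  move=> k1; have := descent_le N_ge0 (leqnn 1) (dist_leS s0 s0_dual) k1.
  by rewrite divr1 => /le_trans; apply; rewrite gerBl divr_ge0 // mulr_ge0.
have sq_le t k j : (s k j - t j) ^+ 2 <= dist t k.
  by rewrite /dist (bigD1 j) //= lerDl sumr_ge0 // => i _; exact: sqr_ge0.
(* The radius [B + 1] avoids a square root: [d ^+ 2 <= B] and [2 * |d| <= d ^+ 2 + 1] give
   [|d| <= B + 1]. *)
pose Q j := `[s0 j - (B + 1), s0 j + (B + 1)].
pose K := [set g : {ptws J -> R} | forall j, [set` Q j] (g j)].
have K_compact : compact K.
  apply: (@tychonoff J (fun=> R) (fun j => [set` Q j])) => j.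
  exact: segment_compact.
have sK i : K (s (n i)).
  move=> j /=; have [_ n1 _] := n_ge i.
  have := le_trans (sq_le s0 (n i) j) (dist_le _ n1).
  rewrite in_itv /= -ler_distl; move: (s _ _ - _) => d d_le.
  have := sqr_ge0 (`|d| - 1); rewrite sqrrB1 real_normK ?num_real //.
  by move: d_le (sqr_ge0 d); move: (B) => ?; lra.
pose sn i : {ptws J -> R} := s (n i).
have [t [_ t_cl]] : K `&` cluster (sn @ \oo) !=set0.
  by apply: K_compact; exists 0%N => // i _; exact: sK.
(* Negated, because [cluster_ge] passes lower bounds to cluster points. *)
have t_dual y : Y y -> lagrangian f D t y <= c.
  move=> Yy; rewrite -lerN2.
  have lag_cont : continuous (fun g : {ptws J -> R} => - lagrangian f D g y).
    by apply: lagrangianN_continuous => j; exact: ptws_eval_continuous.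
  have := cluster_comp lag_cont t_cl.
  have v_cvg : (fun i => - (c + harmonic i)) @ \oo --> - c.
    apply: cvgN; rewrite -[X in _ --> X]addr0.
    by apply: cvgD; [exact: cvg_cst|exact: cvg_harmonic].
  move/cluster_ge/(_ v_cvg); apply => i _; rewrite lerN2.
  have [_ n1 /ltW] := n_ge i; apply: le_trans.
  by have [_] := x_max _ n1; exact.
exists t => j.
have : dist t @ \oo --> 0.
  apply: descent_cvg0 N_ge0 (dist_ge0 t) (dist_leS t t_dual) _ => e m e_gt0.
  have dist_cont :
      continuous (fun g : {ptws J -> R} => \sum_j (g j - t j) ^+ 2).
    by apply: sqr_dist_continuous => i; exact: ptws_eval_continuous.
  have := cluster_comp dist_cont t_cl.
  rewrite big1 => [|i _]; last by rewrite subrr expr0n.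
  move/cluster_eventuallyP/(_ (e / 2) m); rewrite divr_gt0 // => /(_ isT)[i mi].
  rewrite sub0r normrN ger0_norm => [dist_small|]; last exact: dist_ge0.
  have [i_le _ _] := n_ge i; exists (n i); first exact: leq_trans i_le.
  by apply: le_lt_trans dist_small _; rewrite ltr_pdivrMr // ltr_pMr // ltr1n.
move=> /cvgrPdist_lt dist_cvg; apply/cvgrPdist_lt => e e_gt0.
have := dist_cvg (e ^+ 2) (exprn_gt0 _ e_gt0); apply: filterS => k.
rewrite sub0r normrN ger0_norm // distrC => /(le_lt_trans (sq_le t k j)).
by rewrite -real_normK ?num_real // ltr_pXn2r ?nnegrE // ltW.
Qed.

(** By linearity [f] and [D] commute with [mean], and the update rule makes [D j (x i)] equal to
    [i * (s i j - s i.+1 j)]. The point [p] enters only through its values under [f] and [D], so [W]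
    carries no topology. *)
Lemma ergodic_subgradient (R : realType) (W : lmodType R) (J : finType)
    (Y : set W) (f : W -> R) (D : J -> W -> R) (c : R) (s0 : J -> R)
    (s : nat -> J -> R) (x : nat -> W) (p : W) :
  scalar f -> (forall j, scalar (D j)) ->
  (forall y j, Y y -> `|D j y| <= 1) ->
  (forall y, Y y -> lagrangian f D s0 y <= c) ->
  (forall k, (1 <= k)%N -> maximizes Y (lagrangian f D (s k)) (x k)) ->
  (forall k, (1 <= k)%N -> c <= lagrangian f D (s k) (x k)) ->
  (forall k j, (1 <= k)%N -> s k.+1 j = s k j - k%:R^-1 * D j (x k)) ->
  cluster ((f \o mean x) @ \oo) (f p) ->
  (forall j, cluster ((D j \o mean x) @ \oo) (D j p)) ->
  (forall j, D j p = 0) /\ c <= f p.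
Proof.
move=> fL DL D_le1 s0_dual x_max x_ge sS f_cl D_cl.
have [t st] := multipliers_cvg D_le1 s0_dual x_max x_ge sS.
have D_mean j : (D j \o mean x) @ \oo --> 0.
  apply: cvg_trans (mean_steps_cvg0 (st j)).
  apply: near_eq_cvg; apply: nearW => k.
  rewrite /= scalar_mean //; congr (_ * _); apply: eq_big_nat => i /andP[i1 _].
  by rewrite sS // opprB addrC subrK mulVKf // pnatr_eq0 -lt0n.
split=> [j|]; first exact: cluster_cvg_eq (D_cl j) (D_mean j).
have J0 : \sum_(j : J) 0 = 0 :> R by rewrite big1.
(* Bounds the change of the Lagrangian at [x k] when [s k] is replaced by [t], since the violations
   are at most 1 in absolute value. *)
pose eps k := \sum_j `|s k j - t j|.
have eps_cvg : eps @ \oo --> 0.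
  rewrite -[X in _ --> X]J0.
  apply: cvg_sumr => j.
  have : (fun k => `|s k j - t j|) @ \oo --> `|t j - t j|.
    by apply: cvg_norm; apply: cvgB; [exact: st|exact: cvg_cst].
  by rewrite subrr normr0.
(* A lower bound for [f (mean x k)]: average [c - eps i <= lagrangian f D t (x i)] over [i], then
   subtract the penalty term at the mean. *)
pose v k :=
  c - k%:R^-1 * \sum_(1 <= i < k.+1) eps i - \sum_j t j * D j (mean x k).
have v_cvg : v @ \oo --> c.
  rewrite -[X in _ --> X]subr0 -[X in _ --> X]subr0.
  apply: cvgB; first by apply: cvgB; [exact: cvg_cst|exact: cvg_mean].
  rewrite -[X in _ --> X]J0.
  apply: cvg_sumr => j; rewrite -[X in _ --> X](mulr0 (t j)).
  by apply: cvgM; [exact: cvg_cst|exact: D_mean].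
apply: cluster_ge f_cl v_cvg _ => k k1.
rewrite /v /= lerBlDr lerBlDl.
have k_gt0 : 0 < k%:R :> R by rewrite ltr0n.
rewrite -(ler_pM2l k_gt0) mulrDr mulVKf ?gt_eqF //.
have -> : f (mean x k) + \sum_j t j * D j (mean x k)
    = k%:R^-1 * \sum_(1 <= i < k.+1) lagrangian f D t (x i).
  rewrite /lagrangian scalar_mean // big_split /= mulrDr; congr (_ + _).
  rewrite exchange_big /= mulr_sumr; apply: eq_bigr => j _.
  by rewrite scalar_mean // -mulr_sumr mulrCA.
rewrite mulVKf ?gt_eqF // -big_split /=.
have -> : k%:R * c = \sum_(1 <= i < k.+1) c.
  by rewrite sumr_const_nat subn1 mulr_natl.
apply: ler_sum_nat => i /andP[i1 _]; apply: le_trans (x_ge i i1) _.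
rewrite /lagrangian addrCA lerD2l -lerBlDr -sumrB /eps; apply: ler_sum => j _.
rewrite -mulrBl; apply: le_trans (ler_norm _) _.
by rewrite normrM ler_piMr // D_le1 //; have [] := x_max i i1.
Qed.

(** * Functionals depending linearly on finitely many coordinates *)

(** This shape gives linearity and continuity for pointwise convergence at once, with [V] a bare
    type like [pvar M]. *)
Definition finite_form (R : realType) (V : Type) (f : (V -> R) -> R) : Prop :=
  exists (T : finType) (w : T -> R) (v : T -> V),
    forall x, f x = \sum_t w t * x (v t).

Lemma finite_form_eval (R : realType) (V : Type) (v : V) :
  finite_form (fun x : V -> R => x v).
Proof.
exists unit, (fun=> 1), (fun=> v) => x.
by rewrite (bigD1 tt) //= big1 => [|[]//]; rewrite mul1r addr0.
Qed.

Lemma finite_form_sum (R : realType) (V : Type) (T : finType) (w : T -> R)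
    (v : T -> V) :
  finite_form (fun x => \sum_t w t * x (v t)).
Proof. by exists T, w, v. Qed.

Lemma finite_formD (R : realType) (V : Type) (f g : (V -> R) -> R) :
  finite_form f -> finite_form g -> finite_form (fun x => f x + g x).
Proof.
move=> [T [w [v fE]]] [T' [w' [v' gE]]].
exists (T + T')%type, (fun t => match t with inl t => w t | inr t => w' t end),
  (fun t => match t with inl t => v t | inr t => v' t end) => x.
by rewrite big_sumType fE gE.
Qed.

Lemma finite_formN (R : realType) (V : Type) (f : (V -> R) -> R) :
  finite_form f -> finite_form (fun x => - f x).
Proof.
move=> [T [w [v fE]]]; exists T, (fun t => - w t), v => x.
by rewrite fE -sumrN; under [RHS]eq_bigr do rewrite mulNr.
Qed.

Lemma finite_form_scalar (R : realType) (V : Type) (f : (V -> R) -> R) :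
  finite_form f -> scalar f.
Proof.
move=> [T [w [v fE]]] a x y; rewrite !fE mulr_sumr -big_split /=.
by apply: eq_bigr => t _; rewrite mulrDr mulrCA.
Qed.

Lemma finite_form_continuous (R : realType) (V : Type) (f : (V -> R) -> R)
    (T : topologicalType) (g : T -> V -> R) :
  finite_form f -> (forall v, continuous (g ^~ v)) -> continuous (f \o g).
Proof.
move=> [I [w [v fE]]] g_cont; rewrite (_ : f \o g =
  fun x => \sum_i w i * g x (v i)); last by apply/funext => x; rewrite /= fE.
by move=> x; apply: cvg_sumr => i; apply: cvgM; [exact: cvg_cst|exact: g_cont].
Qed.

(** * Problem (P) as an instance of the abstract scheme *)

Definition dup_gap (R : realType) (M : market R) (j : conv_ge M + conv_gh M)
    (x : pvar M -> R) : R :=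
  match j with
  | inl co => x (GeGas co) - x (GeElec co)
  | inr co => x (GhGas co) - x (GhHeat co)
  end.

(** The three balances are put into one family over ['I_3] so that they can serve as equalities in
    [lagrange_multipliers]. *)
Definition imbalance (R : realType) (M : market R) (i : 'I_3)
    (x : pvar M -> R) : R :=
  match val i with
  | 0 => \sum_(o : orders M gas) quantity o * x (Elem gas o)
         - (- \sum_(co : conv_ge M) capacity co * x (GeGas co)
            - \sum_(co : conv_gh M) capacity co * x (GhGas co))
  | 1 => \sum_(o : orders M elec) quantity o * x (Elem elec o)
         - \sum_(co : conv_ge M) output co * x (GeElec co)
  | _ => \sum_(o : orders M heat) quantity o * x (Elem heat o)
         - \sum_(co : conv_gh M) output co * x (GhHeat co)
  end.

Definition relaxed_feasible (R : realType) (M : market R) (x : pvar M -> R) :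
    Prop :=
  (forall i, imbalance i x = 0) /\ (forall v, 0 <= x v <= 1).

Lemma relaxed_feasibleP (R : realType) (M : market R) (x : pvar M -> R) :
  relaxed_feasible x <->
  [/\ gas_balance x, elec_balance x, heat_balance x & forall v, 0 <= x v <= 1].
Proof.
rewrite /gas_balance /elec_balance /heat_balance.
split=> [[x_bal x_box]|[xg xe xh x_box]].
  split=> //; apply/eqP; rewrite -subr_eq0; apply/eqP.
  - exact: (x_bal 0).
  - exact: (x_bal 1).
  - exact: (x_bal 2).
split=> // -[[|[|[|//]]] ?]; rewrite /imbalance /=; apply/eqP; rewrite subr_eq0;
  exact/eqP.
Qed.

Lemma P_feasibleP (R : realType) (M : market R) (x : pvar M -> R) :
  P_feasible x <-> relaxed_feasible x /\ forall j, dup_gap j x = 0.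
Proof.
split=> [[[ge gh] xg xe xh x_box]|[/relaxed_feasibleP[xg xe xh x_box] x_dup]].
  split; first exact/relaxed_feasibleP.
  by case=> co; rewrite /dup_gap ?ge ?gh subrr.
split=> //; split=> co; apply/eqP; rewrite -subr_eq0; apply/eqP.
  exact: (x_dup (inl co)).
exact: (x_dup (inr co)).
Qed.

Lemma finite_form_dup_gap (R : realType) (M : market R)
    (j : conv_ge M + conv_gh M) : finite_form (dup_gap j).
Proof.
by case: j => co; apply: finite_formD (finite_formN _);
  exact: finite_form_eval.
Qed.

Lemma finite_form_imbalance (R : realType) (M : market R) (i : 'I_3) :
  finite_form (@imbalance R M i).
Proof.
case: i => [[|[|[|//]]] ?]; rewrite /imbalance /=;
  do ?[exact: finite_form_sum | apply: finite_formD | apply: finite_formN].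
Qed.

Lemma OmegaE (R : realType) (M : market R) (x : pvar M -> R) :
  Omega x = \sum_(o : orders M gas) limit_price o * quantity o * x (Elem gas o)
  + \sum_(o : orders M elec) limit_price o * quantity o * x (Elem elec o)
  + \sum_(o : orders M heat) limit_price o * quantity o * x (Elem heat o)
  - \sum_(co : conv_ge M) conv_price co * capacity co * x (GeElec co)
  - \sum_(co : conv_gh M) conv_price co * capacity co * x (GhHeat co).
Proof. by rewrite /Omega !big_cons big_nil addr0 !addrA. Qed.

Lemma finite_form_Omega (R : realType) (M : market R) :
  finite_form (@Omega R M).
Proof.
rewrite (funext (@OmegaE R M)).
do ?[exact: finite_form_sum | apply: finite_formD | apply: finite_formN].
Qed.

(** Supplies a finite index for the bounds on the variables, as Farkas' lemma requires. *)
Lemma pvar_finite (R : realType) (M : market R) :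
  exists (T : finType) (v : T -> pvar M), forall u, exists t, v t = u.
Proof.
exists (orders M gas + (orders M elec + (orders M heat +
  ((conv_ge M + conv_ge M) + (conv_gh M + conv_gh M)))))%type.
exists (fun t => match t with
  | inl o => Elem gas o
  | inr (inl o) => Elem elec o
  | inr (inr (inl o)) => Elem heat o
  | inr (inr (inr (inl (inl co)))) => GeGas co
  | inr (inr (inr (inl (inr co)))) => GeElec co
  | inr (inr (inr (inr (inl co)))) => GhGas co
  | inr (inr (inr (inr (inr co)))) => GhHeat co
  end).
case=> [[] o|co|co|co|co].
- by exists (inl o).
- by exists (inr (inl o)).
- by exists (inr (inr (inl o))).
- by exists (inr (inr (inr (inl (inl co))))).
- by exists (inr (inr (inr (inl (inr co))))).
- by exists (inr (inr (inr (inr (inl co))))).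
- by exists (inr (inr (inr (inr (inr co))))).
Qed.

Lemma P_feasible0 (R : realType) (M : market R) : P_feasible (0 : pvar M -> R).
Proof.
apply/P_feasibleP; split=> [|j]; last first.
  exact/scalar0/finite_form_scalar/finite_form_dup_gap.
split=> [i|v]; first exact/scalar0/finite_form_scalar/finite_form_imbalance.
by rewrite /= lexx ler01.
Qed.

(** Multipliers are obtained for the balances and the duplication constraints together; on relaxed
    feasible points the balance terms vanish, leaving those of the duplication. *)
Lemma dual_attained (R : realType) (M : market R) (c : R) :
  (forall y : pvar M -> R, P_feasible y -> Omega y <= c) ->
  exists s : conv_ge M + conv_gh M -> R, forall y : pvar M -> R,
    relaxed_feasible y -> lagrangian (@Omega R M) (@dup_gap R M) s y <= c.
Proof.
move=> Omega_le; have [T [v v_surj]] := pvar_finite M.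
(* With [a], the left copy of [T] encodes [0 <= y] and the right copy [y <= 1]. *)
pose A (i : T + T) (y : pvar M -> R) :=
  match i with inl t => - y (v t) | inr t => y (v t) end.
pose a (i : T + T) : R := match i with inl _ => 0 | inr _ => 1 end.
pose E (j : 'I_3 + (conv_ge M + conv_gh M)) (y : pvar M -> R) :=
  match j with inl i => imbalance i y | inr j => dup_gap j y end.
have A_box y : (forall i, A i y <= a i) <-> forall u, 0 <= y u <= 1.
  split=> [Ay u|y_box [] t /=].
  - have [t <-] := v_surj u; rewrite -oppr_le0.
    by rewrite (Ay (inl t)) (Ay (inr t)).
  - by rewrite oppr_le0; case/andP: (y_box (v t)).
  - by case/andP: (y_box (v t)).
have /P_feasibleP[[bal0 box0] gap0] := P_feasible0 M.
have [|||||y Ay Ey|s s_le] :=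
    @lagrange_multipliers R (pvar M -> R) _ _ A a E (@Omega R M) c 0.
- case=> t; apply: finite_form_scalar; first apply: finite_formN;
    exact: finite_form_eval.
- case=> j; apply: finite_form_scalar.
    exact: finite_form_imbalance.
  exact: finite_form_dup_gap.
- exact/finite_form_scalar/finite_form_Omega.
- exact/A_box.
- by case.
- apply/Omega_le/P_feasibleP; split=> [|j]; last exact: (Ey (inr j)).
  by split=> [i|]; [exact: (Ey (inl i))|exact/A_box].
exists (s \o inr) => y [y_bal /A_box/s_le]; rewrite big_sumType /=.
by rewrite big1 ?add0r // => i _; rewrite y_bal mulr0.
Qed.

Definition multipliers (R : realType) (M : market R) (sge : conv_ge M -> R)
    (sgh : conv_gh M -> R) (j : conv_ge M + conv_gh M) : R :=
  match j with inl co => sge co | inr co => sgh co end.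

Lemma lagrangian_split (R : realType) (M : market R) (sge : conv_ge M -> R)
    (sgh : conv_gh M -> R) (y : pvar M -> R) :
  lagrangian (@Omega R M) (@dup_gap R M) (multipliers sge sgh) y
  = gas_objective sge sgh y + elec_objective sge y + heat_objective sgh y.
Proof.
rewrite /lagrangian OmegaE big_sumType /=.
under [X in _ + (X + _)]eq_bigr do rewrite mulrBr.
under [X in _ + (_ + X)]eq_bigr do rewrite mulrBr.
by rewrite !sumrB /gas_objective /elec_objective /heat_objective; ring.
Qed.

(** The Lagrangian is the sum of the three objectives, and a relaxed feasible point is admissible in
    every subproblem, so the three optimality inequalities add up. *)
Lemma subproblems_maximize (R : realType) (M : market R)
    (sge : conv_ge M -> R) (sgh : conv_gh M -> R) (x : pvar M -> R) :
  solves_subproblems sge sgh x ->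
  maximizes (@relaxed_feasible R M)
    (lagrangian (@Omega R M) (@dup_gap R M) (multipliers sge sgh)) x.
Proof.
case=> -[[xg xg_box] xg_max] [[xe xe_box] xe_max] [[xh xh_box] xh_max].
split=> [|y /relaxed_feasibleP[yg ye yh y_box]].
  apply/relaxed_feasibleP; split=> // u.
  case u_c : (carrier_of u); [exact: xg_box|exact: xe_box|exact: xh_box].
rewrite !lagrangian_split; apply: lerD; first apply: lerD.
- by apply: xg_max; split=> // u _.
- by apply: xe_max; split=> // u _.
- by apply: xh_max; split=> // u _.
Qed.

Lemma averagesE (R : realType) (M : market R) (x : nat -> pvar M -> R) :
  averages x = mean x.
Proof. by apply/funext => k; apply/funext => v; rewrite /mean fct_sumE. Qed.

(** * Transfer to (C) and conclusion *)

Definition duplicate (R : realType) (M : market R) (y : cvar M -> R) :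
    pvar M -> R :=
  fun v => match v with
  | Elem c o => y (CElem c o)
  | GeGas co | GeElec co => y (CGe co)
  | GhGas co | GhHeat co => y (CGh co)
  end.

Lemma P_optimal_C (R : realType) (M : market R) (p : pvar M -> R) :
  P_optimal p -> C_optimal (common_values p).
Proof.
move=> [[[ge gh] pg pe ph p_box] p_max]; split.
  split=> [|||[c o|co|co]] /=; try exact: p_box.
  - by rewrite pg; ring.
  - rewrite pe -sumrB big1 // => co _.
    by rewrite ge subrr.
  - rewrite ph -sumrB big1 // => co _.
    by rewrite gh subrr.
move=> y [yg ye yh y_box].
have -> : Theta (common_values p) = Omega p.
  by rewrite /Theta /Omega; congr (_ - _ - _); apply: eq_bigr => co _;
    rewrite /= ?ge ?gh.
(* [Omega (duplicate y)] is convertible to [Theta y]. *)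
apply: (p_max (duplicate y)); split=> //.
- by move: yg; rewrite /gas_balance /=; lra.
- exact/subr0_eq.
- exact/subr0_eq.
- by case=> *; exact: y_box.
Qed.

Theorem proposition6 (R : realType) (M : market R)
    (sge : nat -> conv_ge M -> R) (sgh : nat -> conv_gh M -> R)
    (x : nat -> pvar M -> R)
    (hx : lagrangian_iteration (fun k => k%:R^-1) sge sgh x)
    (p : pvar M -> R) (hp : cluster (averages x @ \oo) p) :
  P_optimal p /\ C_optimal (common_values p).
Proof.
suff p_opt : P_optimal p by split=> //; exact: P_optimal_C.
pose s k := multipliers (sge k) (sgh k).
pose L := lagrangian (@Omega R M) (@dup_gap R M).
have x_max k : (1 <= k)%N -> maximizes (@relaxed_feasible R M) (L (s k)) (x k).
  by move=> /hx[x_sol _ _]; exact: subproblems_maximize.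
(* Weak duality: the penalty terms vanish at a feasible point of (P). *)
have Omega_le k (y : pvar M -> R) : (1 <= k)%N -> P_feasible y ->
    Omega y <= L (s k) (x k).
  move=> k1 /P_feasibleP[y_rel y_dup]; have [_ /(_ y y_rel)] := x_max k k1.
  by rewrite /L {1}/lagrangian big1 ?addr0 // => j _; rewrite y_dup mulr0.
(* The supremum of [V] serves as the optimal value [c]; that it is attained only follows at the end,
   at [p]. *)
pose V := @Omega R M @` @P_feasible R M.
have V_neq0 : V !=set0.
  by exists (Omega (0 : pvar M -> R)); exists 0 => //; exact: P_feasible0.
have V_sup : has_sup V.
  by split=> //; exists (L (s 1) (x 1)) => _ [y y_feas <-]; exact: Omega_le.
have Omega_le_sup (y : pvar M -> R) : P_feasible y -> Omega y <= sup V.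
  by move=> y_feas; apply: (sup_upper_bound V_sup); exists y.
have [s0 s0_dual] := dual_attained Omega_le_sup.
have form_cl f : finite_form f -> cluster ((f \o mean x) @ \oo) (f p).
  move=> f_form; rewrite -averagesE; apply: cluster_comp hp.
  apply: (finite_form_continuous (g := fun q : {ptws pvar M -> R} => q)) => //.
  move=> v.
  exact: ptws_eval_continuous.
(* Used for a form and its opposite, this carries the balances and both bounds of the box from the
   iterates to [p]. *)
have p_ge f c : finite_form f -> (forall k, (1 <= k)%N -> c <= f (x k)) ->
    c <= f p.
  move=> f_form f_ge.
  apply: (cluster_ge (form_cl f f_form) (cvg_cst c)) => k k1.
  rewrite /= scalar_mean; last exact: finite_form_scalar.
  rewrite ler_pdivlMl ?ltr0n // mulr_natl.
  rewrite -[X in c *+ X](subn1 k.+1) -sumr_const_nat.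
  by apply: ler_sum_nat => i /andP[i1 _]; exact: f_ge.
have [p_dup p_le] : (forall j, dup_gap j p = 0) /\ sup V <= Omega p.
  apply: (@ergodic_subgradient R (pvar M -> R) _ (@relaxed_feasible R M)
    (@Omega R M) (@dup_gap R M) (sup V) s0 s x p) => //.
  - exact/finite_form_scalar/finite_form_Omega.
  - by move=> j; exact/finite_form_scalar/finite_form_dup_gap.
  - move=> y [co|co] [_ y_box] /=; rewrite ler_norml.
      by have := y_box (GeGas co); have := y_box (GeElec co); lra.
    by have := y_box (GhGas co); have := y_box (GhHeat co); lra.
  - by move=> k k1; apply: ge_sup => // _ [y y_feas <-]; exact: Omega_le.
  - by move=> k [co|co] /hx[_ sgeS sghS]; [exact: sgeS|exact: sghS].
  - exact/form_cl/finite_form_Omega.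
  - by move=> j; exact/form_cl/finite_form_dup_gap.
split; last by move=> y /Omega_le_sup/le_trans; exact.
apply/P_feasibleP; split=> //; split=> [i|v].
  have bal0 k : (1 <= k)%N -> imbalance i (x k) = 0 by case/x_max=> -[].
  have i_form := finite_form_imbalance M i.
  apply/eqP; rewrite eq_le -oppr_ge0; apply/andP; split.
    by apply: (p_ge _ 0 (finite_formN i_form)) => k /bal0 ->; rewrite oppr0.
  by apply: (p_ge _ 0 i_form) => k /bal0 ->.
have x_box k : (1 <= k)%N -> 0 <= x k v <= 1 by case/x_max=> -[_ +] _; exact.
apply/andP; split.
  by apply: (p_ge (fun q => q v) 0 (finite_form_eval R v)) => k /x_box/andP[].
rewrite -lerN2.
apply: (p_ge (fun q => - q v) (- 1) (finite_formN (finite_form_eval R v))) => k.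
by rewrite lerN2 => /x_box/andP[].
Qed.
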